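(* There is an absolute constant $c>0$ such that the following holds. Let $H=(V,E)$ be a hypergraph of rank at most $r\ge2$ and maximum degree at most $\Delta$, with an edge-weighting $a$. Let $h'$ be a fractional matching of $H$ with $a(h')\ge a^*(H)/2$, given locally (each edge knows $h'(e)$). 1. There is a deterministic constant-round LOCAL algorithm that produces a $10\Delta$-proper fractional matching $h$ with $a(h)\ge c\,a^*(H)$. 2. There is a randomized constant-round LOCAL algorithm that produces a $\lceil20\log r\rceil$-proper fractional matching $h$ with $\mathbf E[a(h)]\ge c\,a^*(H)$.
   Context: **Fractional matchings.** A fractional matching is $h:E\to[0,1]$ with $\sum_{e\ni v}h(e)\le1$ for every vertex $v$, and $a(h)=\sum_e a(e)h(e)$. Then $a^*(H)$ is the maximum of $a(h)$ over all fractional matchings. **$q$-proper.** A fractional matching is $q$-proper if all its values lie in $\{0,1/q,2/q,\dots\}$. **LOCAL model.** The model is run on the incidence graph of $H$ (one node per vertex and per edge, where $v$ and $e$ are adjacent iff $v\in e$). In synchronous rounds, nodes exchange unbounded messages with neighbours. In the randomized variant, nodes have private random bits. *)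

(* Defs.v *)
From HB Require Import structures.
From mathcomp Require Import all_boot all_order all_algebra.
Set Implicit Arguments. Unset Strict Implicit. Unset Printing Implicit Defensive.
Import Order.TTheory GRing.Theory Num.Theory.
Local Open Scope ring_scope.

Section Hypergraph.
Variables (R : realFieldType) (V E : finType) (ends : E -> {set V}).

Definition frac_matching (h : E -> R) : Prop :=
  (forall e, 0 <= h e <= 1) /\ (forall v, \sum_(e | v \in ends e) h e <= 1).

Definition weight (a h : E -> R) : R := \sum_e a e * h e.

Definition qproper (q : nat) (h : E -> R) : Prop :=
  forall e, exists k : nat, h e = k%:R / q%:R.

Definition is_astar (a : E -> R) (x : R) : Prop :=
  (exists2 h, frac_matching h & weight a h = x) /\
  (forall h, frac_matching h -> weight a h <= x).

Definition rank_le (r : nat) : Prop := forall e, (#|ends e| <= r)%N.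
Definition maxdeg_le (D : nat) : Prop :=
  forall v, (#|[set e | v \in ends e]| <= D)%N.
End Hypergraph.

(* An instance: a hypergraph (iV, iE, iends), edge weights iw, the input
   fractional matching ih0, and identifiers for all nodes of the incidence
   graph. *)
Record instance (R : Type) : Type := Instance {
  iV : finType;
  iE : finType;
  iends : iE -> {set iV};
  iw : iE -> R;
  ih0 : iE -> R;
  iidV : iV -> nat;
  iidE : iE -> nat }.

Section Local.
Variable R : realFieldType.

Definition node (I : instance R) : finType := (iV I + iE I)%type.

Definition iadj (I : instance R) (x y : node I) : bool :=
  match x, y with
  | inl v, inr e => v \in iends e
  | inr e, inl v => v \in iends e
  | _, _ => false
  end.

Fixpoint ball (I : instance R) (T : nat) (x : node I) : {set node I} :=
  match T with
  | 0 => [set x]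
  | T'.+1 => ball T' x :|: [set y | [exists z in ball T' x, iadj z y]]
  end.

(* local input of a node: its identifier, (for edges) weight and h'-value,
   and its private random value of type Om *)
Inductive nlabel (Om : Type) : Type :=
| LV of nat & Om
| LE of nat & R & R & Om.

Definition lab (Om : Type) (I : instance R) (rho : node I -> Om) (x : node I)
  : nlabel Om :=
  match x with
  | inl v => LV (iidV v) (rho (inl v))
  | inr e => LE (iidE e) (iw e) (ih0 e) (rho (inr e))
  end.

Definition nounif (I : instance R) : node I -> unit := fun _ => tt.

Definition ids_unique (I : instance R) : Prop :=
  injective (fun x : node I => match x with inl v => iidV v | inr e => iidE e end).

Definition ball_iso (Om : Type) (T : nat)
  (I1 : instance R) (rho1 : node I1 -> Om) (x1 : node I1)
  (I2 : instance R) (rho2 : node I2 -> Om) (x2 : node I2) : Prop :=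
  exists f : node I1 -> node I2,
    [/\ f x1 = x2,
        {in ball T x1 &, injective f},
        f @: ball T x1 = ball T x2,
        {in ball T x1, forall y, lab rho2 (f y) = lab rho1 y} &
        {in ball T x1 &, forall y z, iadj (f y) (f z) = iadj y z}].

(* A T-round LOCAL algorithm: the output of each edge node depends only on
   the (labelled) radius-T ball around it. *)
Definition local (Om : Type) (T : nat)
  (alg : forall I : instance R, (node I -> Om) -> iE I -> R) : Prop :=
  forall (I1 I2 : instance R) (rho1 : node I1 -> Om) (rho2 : node I2 -> Om)
         (e1 : iE I1) (e2 : iE I2),
    ball_iso T rho1 (inr e1) rho2 (inr e2) -> alg I1 rho1 e1 = alg I2 rho2 e2.

(* Standing assumptions: H a hypergraph (a set system of nonempty edges) of
   rank <= r, r >= 2, max degree <= D, nonnegative weights, unique ids. *)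
Definition good_instance (r D : nat) (I : instance R) : Prop :=
  [/\ (2 <= r)%N /\ injective (@iends R I), (forall e : iE I, iends e != set0),
      rank_le (@iends R I) r, maxdeg_le (@iends R I) D &
      (forall e : iE I, 0 <= iw e) /\ ids_unique I].

(* probability of a random assignment om, each node drawing independently
   from the distribution pr (its own initial label) *)
Definition assign_prob (Om : finType) (pr : nlabel unit -> Om -> R)
  (I : instance R) (om : {ffun node I -> Om}) : R :=
  \prod_(x : node I) pr (lab (@nounif I) x) (om x).

End Local.

(* ceil(20 log_2 r) = least q with r^20 <= 2^q *)
Definition q_rand (r : nat) : nat := up_log 2 (r ^ 20).

(* Main.v *)
Require Import Defs.
From HB Require Import structures.
From mathcomp Require Import all_boot all_order all_algebra.
From mathcomp Require Import ring lra zify.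
Set Implicit Arguments. Unset Strict Implicit. Unset Printing Implicit Defensive.
Import Order.TTheory GRing.Theory Num.Theory.
Local Open Scope ring_scope.

(* Both algorithms keep about half of [h'] and round it to multiples of
   [1 / q]. Deterministically ([q = 10 D]), rounding [h'(e) / 2] up adds at
   most [D / q = 1/10] to a vertex load, and [a(h) >= a(h') / 2].
   Randomly, [q h'(e) / 2] is rounded down to [k_e], and [e] gets one more
   unit when its coin, with bias [1/16] of the rounding loss, shows heads
   and every vertex of [e] sees at most [q / 2] heads; the two parts of a
   vertex load are then at most [q / 2] each. The coin biases at a vertex
   sum to [s <= q / 32], so [u = q / 2] other heads at a vertex occur with
   probability at most [e_u <= s^u / u! <= 2^-u <= 1 / (4 r)]; a union bound
   over the at most [r] vertices of [e] keeps [e] with probability at least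
   half its bias, whence [E a(h) >= a(h') / 64]. *)

Section Rounding.
Variable R : realFieldType.

(* A [realFieldType] has no floor function; [floorn y n] is the floor of
   [y] as long as [0 <= y < n + 1]. *)
Fixpoint floorn (y : R) (n : nat) : nat :=
  match n with 0 => 0%N | n'.+1 => if n%:R <= y then n else floorn y n' end.

Lemma floorn_le y n : 0 <= y -> (floorn y n)%:R <= y.
Proof. by move=> y0; elim: n => [|n IH] //=; case: ifP. Qed.

Lemma floorn_gt y n : y < n%:R + 1 -> y < (floorn y n)%:R + 1.
Proof.
elim: n => [|n IH] /=; first by rewrite add0r.
case: ifP => [//|]; move/negbT; rewrite -ltNge => lt_y _.
by apply: IH; rewrite -natr1 in lt_y.
Qed.

Definition half_units (q : nat) (x : R) : nat := floorn (q%:R * x / 2) q.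

Definition half_rem (q : nat) (x : R) : R := q%:R * x / 2 - (half_units q x)%:R.

Lemma half_unitsP q x : 0 <= x <= 1 ->
  (half_units q x)%:R <= q%:R * x / 2 < (half_units q x)%:R + 1.
Proof.
move=> /andP[x0 x1]; have q0 : 0 <= (q%:R : R) by rewrite ler0n.
have qx : q%:R * x <= q%:R :> R by rewrite -[leRHS]mulr1 ler_wpM2l.
apply/andP; split; first by apply: floorn_le; rewrite divr_ge0 ?mulr_ge0.
by apply: floorn_gt; lra.
Qed.

Lemma half_rem_ge0 q x : 0 <= x <= 1 -> 0 <= half_rem q x.
Proof. by move/(half_unitsP q)/andP=> [? _]; rewrite subr_ge0. Qed.

Lemma half_rem_lt1 q x : 0 <= x <= 1 -> half_rem q x < 1.
Proof. by move/(half_unitsP q)/andP=> [_ ?]; rewrite /half_rem ltrBlDr addrC. Qed.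

Definition round_half (q : nat) (x : R) : R := (half_units q x).+1%:R / q%:R.

Lemma round_half_ge q x : (0 < q)%N -> 0 <= x <= 1 -> x / 2 <= round_half q x.
Proof.
move=> q0 xb; have /andP[_ lt_k] := half_unitsP q xb.
rewrite /round_half ler_pdivlMr ?ltr0n // -[(half_units q x).+1%:R]natr1 [_ * q%:R]mulrC mulrA; lra.
Qed.

Lemma round_half_le q x :
  (0 < q)%N -> 0 <= x <= 1 -> round_half q x <= x / 2 + 1 / q%:R.
Proof.
move=> q0 xb; have /andP[le_k _] := half_unitsP q xb.
rewrite /round_half ler_pdivrMr ?ltr0n // -[(half_units q x).+1%:R]natr1 mulrDl mul1r mulVf ?pnatr_eq0 -?lt0n //.
have -> : x / 2 * q%:R = q%:R * x / 2 by rewrite mulrC mulrA.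
lra.
Qed.

Lemma round_half_le1 q x : (2 <= q)%N -> 0 <= x <= 1 -> round_half q x <= 1.
Proof.
move=> q2 xb; have /andP[le_k _] := half_unitsP q xb.
have q0 : (0 < q)%N by apply: leq_trans q2.
have Q2 : 2 <= (q%:R : R) by rewrite (ler_nat R 2 q).
have /andP[x0 x1] := xb.
have : q%:R * x <= q%:R :> R by rewrite -[leRHS]mulr1 ler_wpM2l // ler0n.
rewrite /round_half ler_pdivrMr ?ltr0n // mul1r -[(half_units q x).+1%:R]natr1; lra.
Qed.

End Rounding.

Section IndependentCoins.
Variables (R : realFieldType) (X : finType) (mu : X -> bool -> R).
Hypothesis mu_sum1 : forall x, mu x true + mu x false = 1.

Lemma expect_prod (g : X -> bool -> R) :
  \sum_(om : {ffun X -> bool}) (\prod_x mu x (om x)) * (\prod_x g x (om x)) =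
  \prod_x \sum_b mu x b * g x b.
Proof. by rewrite bigA_distr_bigA; apply: eq_bigr => om _; rewrite -big_split. Qed.

Lemma expect_all_heads (T : {set X}) :
  \sum_(om : {ffun X -> bool}) (\prod_x mu x (om x)) * \prod_(x in T) (om x)%:R =
  \prod_(x in T) mu x true.
Proof.
pose g x (b : bool) : R := if x \in T then b%:R else 1.
transitivity (\sum_(om : {ffun X -> bool}) (\prod_x mu x (om x)) * \prod_x g x (om x)).
  by apply: eq_bigr => om _; congr (_ * _); rewrite big_mkcond.
rewrite (expect_prod g) [RHS]big_mkcond; apply: eq_bigr => x _.
by rewrite big_bool /g; case: (x \in T) => /=; rewrite ?mulr1 ?mulr0 ?addr0 ?mu_sum1.
Qed.

End IndependentCoins.

Section Factorial.
Variable R : realFieldType.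

Lemma bernoulli_ineq (t : R) n : 0 <= t <= 1 -> 1 - n%:R * t <= (1 - t) ^+ n.
Proof.
move=> /andP[t0 t1]; elim: n => [|n IH]; first by rewrite mul0r subr0 expr0.
rewrite exprSr -natr1.
set P := (1 - t) ^+ n in IH *.
have h1 : 0 <= (P - (1 - n%:R * t)) * (1 - t) by apply: mulr_ge0; lra.
have h2 : 0 <= n%:R * t * t by rewrite !mulr_ge0 ?ler0n.
nra.
Qed.

(* [(1 + 1/n)^n <= 4], from Bernoulli's inequality applied to
   [(1 - 1/(n+1))^(n/2)]. *)
Lemma exp_succ_le (n : nat) : (n.+1%:R : R) ^+ n <= 4%:R * n%:R ^+ n.
Proof.
case: n => [|n]; first by rewrite !expr0 mulr1 ler1n.
set m := n.+1.
have m0 : 0 < (m%:R : R) by rewrite ltr0n.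
have m1 : 0 < (m.+1%:R : R) by rewrite ltr0n.
set t : R := 1 / m.+1%:R.
have t_compl : 1 - t = m%:R / m.+1%:R.
  by rewrite /t -natr1; field; rewrite natr1; exact: lt0r_neq0.
have t01 : 0 <= t <= 1 by rewrite divr_ge0 ?ler0n //= ler_pdivrMr // mul1r ler1n.
set a := uphalf m.
have a2 : (2 * a <= m.+1 <= (2 * a).+1)%N.
  by rewrite /a uphalf_half; have := odd_double_half m; rewrite -muln2; case: (odd m) => /=; lia.
have half_le : 1 / 2 <= (1 - t) ^+ a.
  apply: le_trans (bernoulli_ineq a t01).
  have : (2 * a)%:R <= m.+1%:R :> R by rewrite ler_nat; case/andP: a2.
  rewrite natrM => a_le.
  have : a%:R * t <= 1 / 2 by rewrite /t mulrA mulr1 ler_pdivrMr //; lra.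
  lra.
have quarter_le : 1 / 4 <= (1 - t) ^+ m.
  apply: le_trans (_ : (1 - t) ^+ (2 * a) <= _).
    rewrite mulnC exprM expr2.
    have : 1/2 * (1/2) <= (1 - t) ^+ a * (1 - t) ^+ a by apply: ler_pM => //; lra.
    lra.
  by apply: ler_wiXn2l; [lra | lra | move: a2; rewrite /m; lia].
move: quarter_le; rewrite t_compl expr_div_n ler_pdivlMr ?exprn_gt0 //; lra.
Qed.

Lemma exp_self_le_fact (u : nat) : (u%:R : R) ^+ u <= 4%:R ^+ u * u`!%:R.
Proof.
elim: u => [|u IH]; first by rewrite !expr0 mul1r.
have -> : 4%:R ^+ u.+1 * u.+1`!%:R = u.+1%:R * (4%:R * (4%:R ^+ u * u`!%:R)) :> R.
  by rewrite factS natrM exprS; ring.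
rewrite exprS ler_wpM2l ?ler0n //.
by apply: le_trans (exp_succ_le u) _; rewrite ler_wpM2l ?ler0n.
Qed.

End Factorial.

Lemma small_pow_le_fact (R : realFieldType) (s : R) (u : nat) :
  0 <= s -> s <= 3%:R / 32%:R * u%:R -> s ^+ u <= 2%:R^-1 ^+ u * u`!%:R.
Proof.
move=> s0 s_le; apply: le_trans (_ : (3%:R / 32%:R * u%:R) ^+ u <= _).
  by rewrite lerXn2r // nnegrE (le_trans s0).
rewrite exprMn; apply: le_trans (_ : (3%:R / 32%:R) ^+ u * (4%:R ^+ u * u`!%:R) <= _).
  by rewrite ler_wpM2l ?exp_self_le_fact // exprn_ge0 // divr_ge0 ?ler0n.
rewrite mulrA -exprMn ler_wpM2r ?ler0n // lerXn2r ?nnegrE //; lra.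
Qed.

Section ElementarySymmetric.
Variables (R : realFieldType) (F : finType) (p : F -> R).
Hypothesis p_ge0 : forall f, 0 <= p f.

Definition esymm (A : {set F}) (k : nat) : R :=
  \sum_(S : {set F} | (S \subset A) && (#|S| == k)) \prod_(f in S) p f.

Lemma esymm0 (A : {set F}) : esymm A 0 = 1.
Proof.
rewrite /esymm (big_pred1 set0) ?big_set0 // => S /=.
by rewrite cards_eq0; case: eqP => [->|]; rewrite ?sub0set ?andbF.
Qed.

Lemma esymm_through_le f (A : {set F}) k :
  \sum_(S : {set F} | [&& S \subset A, #|S| == k.+1 & f \in S]) \prod_(g in S :\ f) p g
  <= esymm A k.
Proof.
rewrite (reindex_onto (fun S' => f |: S') (fun S => S :\ f)); last first.
  by move=> S /and3P[_ _ fS]; rewrite setD1K.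
rewrite /esymm big_mkcond [X in _ <= X]big_mkcond /=; apply: ler_sum => S _.
case: ifP => [/andP[/and3P[sub cS _] /eqP E]|_]; last first.
  by case: ifP => // _; apply: prodr_ge0.
have fS : f \notin S.
  by apply/negP => fS; have := setD11 f (f |: S); rewrite E fS.
rewrite E (subset_trans (subsetUr _ _) sub) /=.
by move: cS; rewrite cardsU1 fS add1n eqSS => ->.
Qed.

(* Each [(k+1)]-subset is counted [k+1] times on the right, once for each of
   its elements [f], via [p f] times the product over the remaining [k]. *)
Lemma esymmS_le (A : {set F}) k :
  k.+1%:R * esymm A k.+1 <= (\sum_(f in A) p f) * esymm A k.
Proof.
rewrite /esymm mulr_sumr mulr_suml.
apply: le_trans (_ : \sum_(f in A) p f * \sum_(S : {set F} |
    [&& S \subset A, #|S| == k.+1 & f \in S]) \prod_(g in S :\ f) p g <= _); last first.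
  by apply: ler_sum => f _; rewrite ler_wpM2l ?esymm_through_le.
rewrite le_eqVlt; apply/orP; left; apply/eqP; transitivity (\sum_(S : {set F} | (S \subset A) && (#|S| == k.+1))
    \sum_(f in A) (if f \in S then p f * \prod_(g in S :\ f) p g else 0)).
  apply: eq_bigr => S /andP[sub /eqP cS]; rewrite -big_mkcondr /=.
  have -> : \sum_(f in A | f \in S) p f * \prod_(g in S :\ f) p g =
            \sum_(f in S) p f * \prod_(g in S :\ f) p g.
    apply: eq_bigl => f; case fS: (f \in S); rewrite ?andbF ?andbT //.
    exact: (subsetP sub).
  transitivity (\sum_(f in S) \prod_(g in S) p g); first by rewrite sumr_const cS mulr_natl.
  by apply: eq_bigr => f fS; rewrite [LHS](big_setD1 f fS).
rewrite exchange_big /=; apply: eq_bigr => f fA.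
rewrite mulr_sumr big_mkcond [RHS]big_mkcond /=; apply: eq_bigr => S _.
by case: (S \subset A); case: (#|S| == k.+1); case: (f \in S); rewrite ?mulr0.
Qed.

Lemma esymm_fact_le (A : {set F}) k : esymm A k * k`!%:R <= (\sum_(f in A) p f) ^+ k.
Proof.
have s0 : 0 <= \sum_(f in A) p f by apply: sumr_ge0.
elim: k => [|k IH]; first by rewrite esymm0 fact0 mul1r expr0.
rewrite factS natrM mulrCA mulrA.
apply: le_trans (_ : (\sum_(f in A) p f) * esymm A k * k`!%:R <= _).
  by rewrite ler_wpM2r ?ler0n ?esymmS_le.
by rewrite exprS -mulrA ler_wpM2l.
Qed.

Lemma esymm_le_inv2r (A : {set F}) (u q r : nat) :
  \sum_(f in A) p f <= q%:R / 32%:R -> (q <= 3 * u)%N -> (4 * r <= 2 ^ u)%N ->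
  (0 < r)%N -> esymm A u <= (2 * r)%:R^-1.
Proof.
move=> s_le qu ru r0; have fact0 : 0 < (u`!%:R : R) by rewrite ltr0n fact_gt0.
have : esymm A u * u`!%:R <= 2%:R^-1 ^+ u * u`!%:R.
  apply: le_trans (esymm_fact_le A u) (small_pow_le_fact _ _); first exact: sumr_ge0.
  apply: le_trans s_le _; have : (q%:R : R) <= 3%:R * u%:R by rewrite -natrM ler_nat.
  lra.
rewrite ler_pM2r // => /le_trans; apply.
rewrite exprVn -natrX lef_pV2 ?posrE ?ltr0n ?expn_gt0 ?muln_gt0 // ler_nat.
by apply: leq_trans ru; lia.
Qed.

End ElementarySymmetric.

Lemma exists_subset_card (T : finType) (B : {set T}) k :
  (k <= #|B|)%N -> exists2 S : {set T}, S \subset B & #|S| = k.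
Proof.
elim: k B => [|k IH] B k_le; first by exists set0; rewrite ?sub0set ?cards0.
have [x xB] : exists x, x \in B by apply/card_gt0P; lia.
have /IH[S SB cS] : (k <= #|B :\ x|)%N by move: k_le; rewrite (cardsD1 x B) xB; lia.
exists (x |: S); first by rewrite subUset sub1set xB (subset_trans SB) // subD1set.
have xS : x \notin S by apply/negP => /(subsetP SB); rewrite !inE eqxx.
by rewrite cardsU1 xS cS.
Qed.

Lemma q_randP (r : nat) : (2 <= r)%N ->
  [/\ (20 <= q_rand r)%N, (q_rand r <= 3 * (q_rand r)./2)%N &
      (4 * r <= 2 ^ (q_rand r)./2)%N].
Proof.
move=> r2; set q := q_rand r.
have r20_le : (r ^ 20 <= 2 ^ q)%N by apply: up_logP.
have q20 : (20 <= q)%N.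
  rewrite leqNgt; apply/negP => q_lt.
  have : (2 ^ q <= 2 ^ 19)%N by rewrite leq_pexp2l //; lia.
  have : (2 ^ 20 <= r ^ 20)%N by rewrite leq_exp2r.
  have : (2 ^ 19 < 2 ^ 20)%N by rewrite ltn_exp2l.
  by move: r20_le; generalize (2 ^ q)%N (2 ^ 19)%N (2 ^ 20)%N (r ^ 20)%N => *; lia.
set u := q./2.
have q_split : (q = odd q + 2 * u)%N by rewrite /u; have := odd_double_half q; rewrite -muln2; lia.
split => //; first by move: q_split; case: (odd q) => /=; lia.
have q_le : (2 ^ q <= 2 * (2 ^ u) ^ 2)%N.
  rewrite -expnM -expnS leq_pexp2l //.
  by move: q_split; case: (odd q) => /=; lia.
have r18 : (2 ^ 5 <= r ^ 18)%N.
  by apply: (@leq_trans (2 ^ 18)); [rewrite leq_pexp2l | rewrite leq_exp2r].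
have r20 : (r ^ 20 = r ^ 2 * r ^ 18)%N by rewrite -expnD.
rewrite -leq_sqr expnMn (_ : 4 ^ 2 = 16)%N //.
have : (2 ^ 5 * r ^ 2 <= r ^ 18 * r ^ 2)%N by rewrite leq_mul.
move: r20_le q_le r18; rewrite r20 (_ : 2 ^ 5 = 32)%N //.
by generalize (r ^ 18)%N (r ^ 2)%N ((2 ^ u) ^ 2)%N (2 ^ q)%N => a b c d; nia.
Qed.

Section DeterministicRounding.
Variables (R : realFieldType) (V E : finType) (ends : E -> {set V}) (D : nat).
Hypotheses (ends_neq0 : forall e, ends e != set0) (maxdeg : maxdeg_le ends D).

Lemma maxdeg_gt0 (e : E) : (0 < D)%N.
Proof.
have [v ve] := set0Pn _ (ends_neq0 e).
by apply: leq_trans (maxdeg v); apply/card_gt0P; exists e; rewrite inE.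
Qed.

Lemma sum_star_const (v : V) (c : R) :
  \sum_(e | v \in ends e) c = #|[set e | v \in ends e]|%:R * c.
Proof.
rewrite (eq_bigl (fun e => e \in [set e | v \in ends e])) => [|e]; last by rewrite inE.
by rewrite sumr_const mulr_natl.
Qed.

Let q := (10 * D)%N.

Lemma round_half_frac_matching (h : E -> R) :
  frac_matching ends h -> frac_matching ends (fun e => round_half q (h e)).
Proof.
move=> [h01 hsum]; have q2 (e : E) : (2 <= q)%N by have := maxdeg_gt0 e; rewrite /q; lia.
split=> [e|v].
  apply/andP; split; last exact: round_half_le1 (q2 e) (h01 e).
  by rewrite divr_ge0 ?ler0n.
apply: le_trans (_ : \sum_(e | v \in ends e) (h e / 2 + 1 / q%:R) <= 1).
  by apply: ler_sum => e _; apply: round_half_le (h01 e); apply: leq_trans (q2 e).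
rewrite big_split /= -mulr_suml sum_star_const mul1r.
have : D%:R / q%:R <= 1 / 10%:R :> R.
  rewrite /q natrM; case: (posnP D) => [->|D0]; first by rewrite mulr0 invr0 mulr0 divr_ge0.
  by rewrite invfM mulrCA mulfV ?pnatr_eq0 -?lt0n // mulr1 mul1r.
have : #|[set e | v \in ends e]|%:R / q%:R <= D%:R / q%:R :> R.
  by rewrite ler_wpM2r ?invr_ge0 ?ler0n ?ler_nat.
have := hsum v; clear hsum q2; lra.
Qed.

Lemma round_half_weight (a h : E -> R) : (forall e, 0 <= a e) ->
  frac_matching ends h -> weight a h / 2 <= weight a (fun e => round_half q (h e)).
Proof.
move=> a0 [h01 _]; rewrite /weight mulr_suml; apply: ler_sum => e _.
have q0 : (0 < q)%N by have := maxdeg_gt0 e; rewrite /q; lia.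
by rewrite -mulrA ler_wpM2l // round_half_ge.
Qed.

End DeterministicRounding.

Section Balls.
Variables (R : realFieldType) (I : instance R).

Lemma ball_center T (x : node I) : x \in ball T x.
Proof. by elim: T => [|T IH] /=; rewrite ?in_set1 ?in_setU ?IH. Qed.

Lemma ballS T (x y : node I) : y \in ball T x -> y \in ball T.+1 x.
Proof. by move=> yB /=; rewrite in_setU yB. Qed.

Lemma ball_adj T (x y z : node I) : z \in ball T x -> iadj z y -> y \in ball T.+1 x.
Proof.
by move=> zB zy /=; rewrite in_setU inE; apply/orP; right; apply/existsP; exists z; rewrite zB.
Qed.

Lemma ball2_vertex (e : iE I) v : v \in iends e -> inl v \in ball 2 (inr e).
Proof.
by move=> ve; apply/ballS/(ball_adj (z := inr e)) => //; apply: ball_center.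
Qed.

Lemma ball2_edge (e f : iE I) v :
  v \in iends e -> v \in iends f -> inr f \in ball 2 (inr e).
Proof.
move=> ve vf; apply: (ball_adj (z := inl v)) => //.
by apply: (ball_adj (z := inr e)) => //; apply: ball_center.
Qed.

End Balls.

Section Labels.
Variables (R : realFieldType) (Om : Type) (I1 I2 : instance R).
Variables (rho1 : node I1 -> Om) (rho2 : node I2 -> Om).

Lemma lab_edgeP z (f : iE I1) : lab rho2 z = lab rho1 (inr f) ->
  exists f', [/\ z = inr f', ih0 f' = ih0 f & rho2 z = rho1 (inr f)].
Proof. by case: z => [v|f'] //= [] _ _ h0f rhof; exists f'. Qed.

Lemma lab_vertexP z (v : iV I1) : lab rho2 z = lab rho1 (inl v) ->
  exists v', z = inl v' /\ rho2 z = rho1 (inl v).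
Proof. by case: z => [v'|f'] //= [] _ rhov; exists v'. Qed.

End Labels.

Section Algorithms.
Variable R : realFieldType.

Definition det_round (D : nat) (I : instance R) (e : iE I) : R :=
  round_half (10 * D) (ih0 e).

(* The guard only matters for inputs [x] outside [[0, 1]]; it makes
   [coin_distr] a probability distribution on every label. *)
Definition coin_prob (q : nat) (x : R) : R :=
  let p := half_rem q x / 16%:R in if 0 <= p <= 1 then p else 0.

Definition coin_distr (r : nat) (l : nlabel R unit) (b : bool) : R :=
  match l with
  | LV _ _ => (~~ b)%:R
  | LE _ _ x _ => if b then coin_prob (q_rand r) x else 1 - coin_prob (q_rand r) x
  end.

Definition heads_deg (I : instance R) (om : node I -> bool) (v : iV I) : nat :=
  #|[set f : iE I | (v \in iends f) && om (inr f)]|.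

Definition kept (q : nat) (I : instance R) (om : node I -> bool) (e : iE I) : bool :=
  om (inr e) && [forall v, (v \in iends e) ==> (2 * heads_deg om v <= q)%N].

Definition rand_round (r : nat) (I : instance R) (om : node I -> bool) (e : iE I) : R :=
  (half_units (q_rand r) (ih0 e) + kept (q_rand r) om e)%:R / (q_rand r)%:R.

Definition heads_star (I : instance R) (om : node I -> bool) (v : iV I) : {set node I} :=
  [set inr f | f in [set f : iE I | (v \in iends f) && om (inr f)]].

Lemma card_heads_star I om v : #|@heads_star I om v| = heads_deg om v.
Proof. by rewrite card_imset // => f g [->]. Qed.

End Algorithms.

Section BallIsomorphism.
Variables (R : realFieldType) (I1 I2 : instance R).
Variables (rho1 : node I1 -> bool) (rho2 : node I2 -> bool).
Variables (e1 : iE I1) (e2 : iE I2) (phi : node I1 -> node I2).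
Hypotheses (phi_e : phi (inr e1) = inr e2)
  (phi_inj : {in ball 2 (inr e1) &, injective phi})
  (phi_onto : phi @: ball 2 (inr e1) = ball 2 (inr e2))
  (phi_lab : {in ball 2 (inr e1), forall y, lab rho2 (phi y) = lab rho1 y})
  (phi_adj : {in ball 2 (inr e1) &, forall y z, iadj (phi y) (phi z) = iadj y z}).

Lemma ih0_iso : ih0 e2 = ih0 e1.
Proof.
have [f [phi_f <- _]] := lab_edgeP (phi_lab (ball_center _ _)).
by move: phi_f; rewrite phi_e => -[->].
Qed.

Lemma iso_vertex v : v \in iends e1 ->
  exists2 v', phi (inl v) = inl v' & v' \in iends e2.
Proof.
move=> ve; have vB := ball2_vertex ve.
have [v' [phi_v _]] := lab_vertexP (phi_lab vB).
by exists v'; have := phi_adj vB (ball_center _ _); rewrite phi_e phi_v /= ve.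
Qed.

Lemma iso_vertex_onto v' : v' \in iends e2 ->
  exists2 v, v \in iends e1 & phi (inl v) = inl v'.
Proof.
move=> ve'; have := ball2_vertex ve'; rewrite -phi_onto => /imsetP[[v|f] xB phi_x].
  by exists v => //; have := phi_adj xB (ball_center _ _); rewrite phi_e -phi_x /= ve'.
by have [f' [phi_f _ _]] := lab_edgeP (phi_lab xB); rewrite phi_f in phi_x.
Qed.

Lemma iso_heads_star v v' : v \in iends e1 -> phi (inl v) = inl v' ->
  phi @: heads_star rho1 v = heads_star rho2 v'.
Proof.
move=> ve phi_v; have vB := ball2_vertex ve.
have ve' : v' \in iends e2.
  by have := phi_adj vB (ball_center _ _); rewrite phi_v phi_e /= ve.
apply/setP=> y; apply/imsetP/imsetP.
- move=> [x /imsetP[f]]; rewrite inE => /andP[vf rf] -> ->.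
  have fB := ball2_edge ve vf; have [f' [phi_f _ rf']] := lab_edgeP (phi_lab fB).
  exists f' => //; rewrite inE -phi_f rf' rf andbT.
  by have := phi_adj vB fB; rewrite phi_v phi_f /= vf.
- move=> [f']; rewrite inE => /andP[vf' rf'] ->.
  have := ball2_edge ve' vf'; rewrite -phi_onto => /imsetP[[w|f] xB phi_x].
    by have [w' [phi_w _]] := lab_vertexP (phi_lab xB); rewrite phi_w in phi_x.
  have [f2 [phi_f _ rf]] := lab_edgeP (phi_lab xB).
  exists (inr f) => //; apply/imsetP; exists f => //; rewrite inE -rf -phi_x rf' andbT.
  by have := phi_adj vB xB; rewrite phi_v -phi_x /= vf'.
Qed.

Lemma heads_deg_iso v v' : v \in iends e1 -> phi (inl v) = inl v' ->
  heads_deg rho1 v = heads_deg rho2 v'.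
Proof.
move=> ve phi_v; rewrite -!card_heads_star -(iso_heads_star ve phi_v) card_in_imset //.
move=> x y /imsetP[f]; rewrite inE => /andP[vf _] -> /imsetP[g]; rewrite inE => /andP[vg _] ->.
exact: phi_inj (ball2_edge ve vf) (ball2_edge ve vg).
Qed.

Lemma kept_iso q : kept q rho1 e1 = kept q rho2 e2.
Proof.
have [_ [_ _ r_e]] := lab_edgeP (phi_lab (ball_center _ _)).
rewrite /kept -r_e phi_e; congr andb; apply/forallP/forallP => deg_ok v.
- apply/implyP => ve'; have [w we phi_w] := iso_vertex_onto ve'.
  by rewrite -(heads_deg_iso we phi_w); exact: (implyP (deg_ok w) we).
- apply/implyP => ve; have [v' phi_v ve'] := iso_vertex ve.
  by rewrite (heads_deg_iso ve phi_v); exact: (implyP (deg_ok v') ve').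
Qed.

End BallIsomorphism.

Lemma det_round_local (R : realFieldType) (D : nat) :
  local 0 (fun I (_ : node I -> unit) => @det_round R D I).
Proof.
move=> I1 I2 rho1 rho2 e1 e2 [phi [phi_e _ _ phi_lab _]].
by have := phi_lab (inr e1) (ball_center _ _); rewrite phi_e /det_round => -[_ _ ->].
Qed.

Lemma rand_round_local (R : realFieldType) (r : nat) : local 2 (@rand_round R r).
Proof.
move=> I1 I2 rho1 rho2 e1 e2 [phi [phi_e phi_inj phi_onto phi_lab phi_adj]].
by rewrite /rand_round (ih0_iso phi_e phi_lab) (kept_iso phi_e phi_inj phi_onto phi_lab phi_adj).
Qed.

Section RandomizedRounding.
Variable R : realFieldType.

Lemma coin_prob01 q (x : R) : 0 <= coin_prob q x <= 1.
Proof. by rewrite /coin_prob; case: ifP => // _; rewrite lexx ler01. Qed.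

Lemma coin_probE q (x : R) : 0 <= x <= 1 -> coin_prob q x = half_rem q x / 16%:R.
Proof.
move=> xb; rewrite /coin_prob ifT //.
have r0 := half_rem_ge0 q xb; have r1 := half_rem_lt1 q xb.
by rewrite divr_ge0 ?ler0n //= ler_pdivrMr ?ltr0n // mul1r (le_trans (ltW r1)) ?ler1n.
Qed.

Lemma coin_distr_prob r (l : nlabel R unit) :
  (forall b, 0 <= coin_distr r l b) /\ \sum_b coin_distr r l b = 1.
Proof.
case: l => [? ?|? ? x ?]; rewrite /= big_bool /=; first by split=> [[]|]; rewrite ?ler01 ?add0r.
have /andP[p0 p1] := coin_prob01 (q_rand r) x.
by split=> [[]|]; rewrite ?subr_ge0 // addrC subrK.
Qed.

(* A kept edge certifies that each of its vertices sees at most [q / 2]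
   heads, hence at most [q / 2] kept edges. *)
Lemma sum_kept_le q (I : instance R) (om : node I -> bool) (v : iV I) :
  (2 * \sum_(e | v \in iends e) kept q om e <= q)%N.
Proof.
have [/existsP[e /andP[ve /andP[_ /forallP /(_ v)]]]|no_kept] :=
  boolP [exists e, (v \in iends e) && kept q om e].
  rewrite ve /= => /(leq_trans _); apply; rewrite leq_mul2l /= /heads_deg -sum1_card.
  rewrite big_mkcond [X in (_ <= X)%N]big_mkcond /=; apply: leq_sum => f _.
  by rewrite inE /kept; case: (v \in iends f); case: (om (inr f)); rewrite /= ?leq_b1.
rewrite big1 // => e ve; case ke: (kept q om e) => //.
by case/negP: no_kept; apply/existsP; exists e; rewrite ve ke.
Qed.

Lemma rand_round_valid (r : nat) (I : instance R) (om : node I -> bool) :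
  (2 <= r)%N -> frac_matching (@iends R I) (@ih0 R I) ->
  frac_matching (@iends R I) (rand_round r om) /\ qproper (q_rand r) (rand_round r om).
Proof.
move=> r2 [h01 hsum]; have [q20 _ _] := q_randP r2.
set q := q_rand r in q20 *; have q0 : 0 < (q%:R : R) by rewrite ltr0n; lia.
split; last by move=> e; exists (half_units q (ih0 e) + kept q om e)%N.
have units_le (e : iE I) : (half_units q (ih0 e))%:R <= q%:R * ih0 e / 2.
  by case/andP: (half_unitsP q (h01 e)).
split=> [e|v].
  rewrite /rand_round -/q divr_ge0 ?ler0n //= ler_pdivrMr // mul1r natrD.
  have : ((kept q om e : nat)%:R : R) <= 1 by case: (kept _ _ _).
  have : q%:R * ih0 e <= q%:R :> R.
    by rewrite -[leRHS]mulr1 ler_wpM2l ?(ltW q0) //; case/andP: (h01 e).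
  have := units_le e; have : (20 <= q%:R :> R) by rewrite ler_nat.
  clear; lra.
rewrite /rand_round -/q -mulr_suml ler_pdivrMr // mul1r.
under eq_bigr do rewrite natrD; rewrite big_split /=.
have : \sum_(e | v \in iends e) ((half_units q (ih0 e))%:R : R) <= q%:R / 2.
  apply: le_trans (_ : \sum_(e | v \in iends e) q%:R * ih0 e / 2 <= _).
    by apply: ler_sum => e _; apply: units_le.
  rewrite -mulr_suml -mulr_sumr ler_pM2r ?invr_gt0 ?ltr0n //.
  by rewrite -[leRHS]mulr1 ler_wpM2l ?(ltW q0).
have : (2 * \sum_(e | v \in iends e) (kept q om e : nat))%:R <= q%:R :> R.
  by rewrite ler_nat sum_kept_le.
rewrite natrM natr_sum; clear; lra.
Qed.

End RandomizedRounding.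

Section KeptLowerBound.
Variables (R : realFieldType) (I : instance R).

Definition heads (T : {set iE I}) (om : node I -> bool) : R :=
  \prod_(f in T) (om (inr f))%:R.

Definition star_but (v : iV I) (e : iE I) : {set iE I} :=
  [set f | (v \in iends f) && (f != e)].

Lemma heads_ge0 T om : 0 <= heads T om.
Proof. by apply: prodr_ge0 => f _; rewrite ler0n. Qed.

(* If [e] flips heads but is not kept, some vertex [v] of [e] sees more than
   [q / 2] heads, so some [q./2] other edges at [v] flip heads too. *)
Lemma kept_ge q om e :
  heads [set e] om - \sum_(v in iends e) \sum_(S : {set iE I} |
    (S \subset star_but v e) && (#|S| == q./2)) heads (e |: S) om <= (kept q om e)%:R.
Proof.
set union := \sum_(v in iends e) _.
have union_ge0 : 0 <= union by do 2!apply: sumr_ge0 => ? _; apply: heads_ge0.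
rewrite /heads big_set1 -/(heads _ _); case ae: (om (inr e)) => /=; last first.
  by rewrite /kept ae subr_le0.
case ke: (kept q om e); first by rewrite lerBlDr lerDl.
suff : 1 <= union by rewrite subr_le0.
move: ke; rewrite /kept ae /= => /negbT; rewrite negb_forall => /existsP[v].
rewrite negb_imply -ltnNge => /andP[ve many_heads].
set A := [set f | (v \in iends f) && om (inr f)] in many_heads.
have eA : e \in A by rewrite inE ve ae.
have : (q./2 <= #|A :\ e|)%N.
  by move: many_heads; rewrite /heads_deg -/A (cardsD1 e A) eA; lia.
case/exists_subset_card => S SA cS.
have S_star : S \subset star_but v e.
  by apply/subsetP => f /(subsetP SA); rewrite !inE => /andP[-> /andP[-> _]].
rewrite /union (bigD1 v) //= (bigD1 S) /=; last by rewrite S_star cS eqxx.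
have -> : heads (e |: S) om = 1.
  rewrite /heads big1 // => f; rewrite !inE => /orP[/eqP -> | /(subsetP SA)]; first by rewrite ae.
  by rewrite !inE => /andP[_ /andP[_ ->]].
rewrite -addrA lerDl addr_ge0 //; first by apply: sumr_ge0 => ? _; apply: heads_ge0.
by do 2!apply: sumr_ge0 => ? _; apply: heads_ge0.
Qed.

End KeptLowerBound.

Section ExpectedWeight.
Variables (R : realFieldType) (r D : nat) (I : instance R).
Hypotheses (good : good_instance r D I) (fm : frac_matching (@iends R I) (@ih0 R I)).

Let q := q_rand r.
Let P (om : {ffun node I -> bool}) : R := assign_prob (@coin_distr R r) om.
Let pe (f : iE I) : R := coin_prob q (ih0 f).

Lemma r_ge2 : (2 <= r)%N. Proof. by case: good => -[]. Qed.

Lemma pe_ge0 f : 0 <= pe f.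
Proof. by case/andP: (coin_prob01 q (ih0 f)). Qed.

Lemma expect_heads (T : {set iE I}) : \sum_om P om * heads T om = \prod_(f in T) pe f.
Proof.
have mu_sum1 x : coin_distr r (lab (@nounif R I) x) true +
                 coin_distr r (lab (@nounif R I) x) false = 1.
  by have [_] := coin_distr_prob r (lab (@nounif R I) x); rewrite big_bool.
have inr_inj : {in T &, injective (@inr (iV I) (iE I))} by move=> ? ? _ _ [].
transitivity (\sum_om P om * \prod_(x in inr @: T) (om x)%:R).
  by apply: eq_bigr => om _; rewrite big_imset.
rewrite /P /assign_prob.
by rewrite (@expect_all_heads _ _ (fun x => coin_distr r (lab (@nounif R I) x))) ?big_imset.
Qed.

Lemma sum_star_but_pe_le v e : \sum_(f in star_but v e) pe f <= q%:R / 32%:R.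
Proof.
case: fm => h01 hsum.
apply: le_trans (_ : \sum_(f | v \in iends f) pe f <= _).
  rewrite big_mkcond [leRHS]big_mkcond /=; apply: ler_sum => f _.
  by rewrite inE; case: (v \in iends f); case: (f != e); rewrite ?pe_ge0.
apply: le_trans (_ : \sum_(f | v \in iends f) (q%:R * ih0 f / 2) / 16%:R <= _).
  apply: ler_sum => f _; rewrite /pe coin_probE // ler_pM2r ?invr_gt0 ?ltr0n //.
  by rewrite /half_rem lerBlDr lerDl ler0n.
rewrite -!mulr_suml -mulr_sumr.
have : q%:R * \sum_(f | v \in iends f) ih0 f <= q%:R :> R.
  by rewrite -[leRHS]mulr1 ler_wpM2l ?ler0n.
lra.
Qed.

Lemma prob_kept_ge e : pe e / 2 <= \sum_om P om * (kept q om e)%:R.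
Proof.
have [_ qu ru] := q_randP r_ge2; rewrite -/q in qu ru.
set u := q./2 in qu ru *.
set union := fun (om : node I -> bool) => \sum_(v in iends e) \sum_(S : {set iE I} |
    (S \subset star_but v e) && (#|S| == u)) heads (e |: S) om.
have P_ge0 om : 0 <= P om.
  by apply: prodr_ge0 => x _; case: (coin_distr_prob r (lab (@nounif R I) x)).
apply: le_trans (_ : \sum_om P om * (heads [set e] om - union om) <= _); last first.
  by apply: ler_sum => om _; rewrite ler_wpM2l ?kept_ge.
have expect_union : \sum_om P om * union om =
    pe e * \sum_(v in iends e) esymm pe (star_but v e) u.
  under eq_bigr do rewrite mulr_sumr; rewrite exchange_big mulr_sumr /=.
  apply: eq_bigr => v _; under eq_bigr do rewrite mulr_sumr.
  rewrite exchange_big /= /esymm mulr_sumr; apply: eq_bigr => S /andP[S_star _].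
  rewrite expect_heads big_setU1 //=.
  by apply/negP => /(subsetP S_star); rewrite inE eqxx andbF.
have esymm_small v : esymm pe (star_but v e) u <= (2 * r)%:R^-1.
  by apply: (esymm_le_inv2r pe_ge0 (sum_star_but_pe_le v e) qu ru); have := r_ge2; lia.
have : \sum_(v in iends e) esymm pe (star_but v e) u <= 2%:R^-1.
  apply: le_trans (_ : \sum_(v in iends e) (2 * r)%:R^-1 <= _); first exact: ler_sum.
  have r_gt0 : (0 < r)%N by have := r_ge2; lia.
  have : (#|iends e| <= r)%N by case: good => _ _ /(_ e).
  rewrite sumr_const -[_ *+ _]mulr_natl ler_pdivrMr ?ltr0n ?muln_gt0 // natrM mulrA.
  by rewrite mulVf ?pnatr_eq0 // mul1r ler_nat.
move=> /(ler_wpM2l (pe_ge0 e)) esymm_sum.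
under eq_bigr do rewrite mulrBr; rewrite sumrB expect_heads big_set1 expect_union.
have := pe_ge0 e; lra.
Qed.

Lemma expected_weight_ge :
  weight (@iw R I) (@ih0 R I) / 64%:R <= \sum_om P om * weight (@iw R I) (rand_round r om).
Proof.
have P_sum1 : \sum_om P om = 1.
  have := expect_heads set0; rewrite big_set0 => <-.
  by apply: eq_bigr => om _; rewrite /heads big_set0 mulr1.
have [q20 _ _] := q_randP r_ge2.
have q0 : 0 < (q%:R : R) by rewrite ltr0n; lia.
case: good => _ _ _ _ [w_ge0 _]; case: fm => h01 _.
rewrite /weight mulr_suml; under [leRHS]eq_bigr do rewrite mulr_sumr.
rewrite [leRHS]exchange_big /=; apply: ler_sum => e _.
set k : R := (half_units q (ih0 e))%:R.
set E := \sum_om P om * (kept q om e)%:R.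
have -> : \sum_om P om * (iw e * rand_round r om e) = iw e * ((k + E) / q%:R).
  transitivity (\sum_om iw e / q%:R * (k * P om + P om * (kept q om e)%:R)).
    by apply: eq_bigr => om _; rewrite /rand_round natrD -/q -/k; ring.
  by rewrite -mulr_sumr big_split /= -mulr_sumr P_sum1 mulr1 -/E; ring.
rewrite -mulrA ler_wpM2l // ler_pdivlMr //.
have := prob_kept_ge e; rewrite -/E /pe coin_probE // /half_rem -/q -/k.
have -> : ih0 e / 64%:R * q%:R = (q%:R * ih0 e / 2) / 32%:R by field.
have : 0 <= k by rewrite ler0n.
lra.
Qed.

End ExpectedWeight.

Lemma weight_ge0 (R : realFieldType) (r D : nat) (I : instance R) :
  good_instance r D I -> frac_matching (@iends R I) (@ih0 R I) ->
  0 <= weight (@iw R I) (@ih0 R I).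
Proof.
move=> [_ _ _ _ [w_ge0 _]] [h01 _]; apply: sumr_ge0 => e _.
by rewrite mulr_ge0 //; case/andP: (h01 e).
Qed.

Theorem propositionB2 :
  exists c : rat, 0 < c /\
  (* 1. deterministic *)
  (exists T : nat, forall R : realFieldType,
    exists alg : nat -> nat -> forall I : instance R, iE I -> R,
      (forall r D, local T (fun I (_ : node I -> unit) => alg r D I)) /\
      (forall (r D : nat) (I : instance R),
        good_instance r D I ->
        frac_matching (@iends R I) (@ih0 R I) ->
        forall astar : R, is_astar (@iends R I) (@iw R I) astar ->
        astar / 2 <= weight (@iw R I) (@ih0 R I) ->
        [/\ frac_matching (@iends R I) (alg r D I),
            qproper (10 * D) (alg r D I) &
            ratr c * astar <= weight (@iw R I) (alg r D I)])) /\
  (* 2. randomized *)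
  (exists T : nat, forall R : realFieldType,
    exists (Om : finType) (pr : nat -> nat -> nlabel R unit -> Om -> R)
           (alg : nat -> nat -> forall I : instance R, (node I -> Om) -> iE I -> R),
      (forall r D l, (forall o, 0 <= pr r D l o) /\ \sum_o pr r D l o = 1) /\
      (forall r D, local T (alg r D)) /\
      (forall (r D : nat) (I : instance R),
        good_instance r D I ->
        frac_matching (@iends R I) (@ih0 R I) ->
        forall astar : R, is_astar (@iends R I) (@iw R I) astar ->
        astar / 2 <= weight (@iw R I) (@ih0 R I) ->
        (forall om : {ffun node I -> Om}, assign_prob (pr r D) om != 0 ->
           frac_matching (@iends R I) (alg r D I om) /\
           qproper (q_rand r) (alg r D I om)) /\
        ratr c * astar <=
          \sum_(om : {ffun node I -> Om})
             assign_prob (pr r D) om * weight (@iw R I) (alg r D I om))).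
Proof.
exists (128%:R^-1); split; first by rewrite invr_gt0 ltr0n.
have ratr_c (R : realFieldType) : ratr (128%:R^-1 : rat) = 128%:R^-1 :> R by rewrite fmorphV rmorph_nat.
split.
- exists 0%N => R; exists (fun _ D I => @det_round R D I); split => [r D|r D I good fm astar _ half_le].
    exact: det_round_local.
  case: (good) => _ ends_neq0 _ maxdeg [w_ge0 _].
  split; [exact: round_half_frac_matching | by move=> e; eexists |].
  have := weight_ge0 good fm; have := round_half_weight ends_neq0 maxdeg w_ge0 fm.
  by rewrite ratr_c; lra.
- exists 2%N => R; exists bool, (fun r _ => @coin_distr R r), (fun r _ => @rand_round R r).
  split; first by move=> r _ l; exact: coin_distr_prob.
  split=> [r D|r D I good fm astar _ half_le]; first exact: rand_round_local.
  have r2 : (2 <= r)%N by case: good => -[].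
  split; first by move=> om _; exact: rand_round_valid.
  have w0 := weight_ge0 good fm; have := expected_weight_ge good fm.
  by rewrite ratr_c; lra.
Qed.
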